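(* Suppose that the dynamics $P$ and the recovery policy $\pi^{\mathrm{rec}}$ are both deterministic. Let $s_t$ be a recovery-triggering state, let $k\ge1$ be the number of recovery steps until either re-entry into the safe region $\mathcal R$ at time $t+k$ (success) or termination at time $t+k$ (failure), and let $G_{t,k}=\sum_{j=0}^{k-1}\gamma^j r_{t+j}$ be the realized segment return. Then the mixed-policy value satisfies $$V^{\pi_\theta^{\mathrm{mix}}}(s_t)=\begin{cases}G_{t,k}+\gamma^k\,V^{\pi_\theta^{\mathrm{mix}}}(s_{t+k})&\text{(success)},\\ G_{t,k}&\text{(failure)}.\end{cases}$$ Under the convention that recovery accrues zero per-step task reward and failure incurs a one-time terminal failure reward $r_{\mathrm{term}}$ (accrued at the final segment step $t+k-1$), the segment return $G_{t,k}$ is $0$ on success and $\gamma^{k-1}r_{\mathrm{term}}$ on failure. In practice the re-entry value is bootstrapped with the learned critic $V_\theta$, that is, under this convention the value written for $s_t$ into the rollout buffer on success is $\gamma^k V_\theta(s_{t+k})$; this carries no Monte-Carlo variance under deterministic $P$ and $\pi^{\mathrm{rec}}$.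
   Context: Setting: an infinite-horizon discounted Markov decision process with state space $\mathcal S$, action space $\mathcal A$, transition kernel $P$, bounded reward ($r_t$ denotes the reward at step $t$, $|r_t|\le r_{\max}$) and discount $\gamma\in(0,1)$. Failure states are terminal (absorbing): the episode ends there and no further reward accrues. $\mathcal R\subseteq\mathcal S$ is the safe region. The mixed policy $\pi_\theta^{\mathrm{mix}}$ follows a stochastic $\theta$-parameterized main policy $\pi_\theta(\cdot\mid s)$ at states $s\in\mathcal R$ and the recovery policy $\pi^{\mathrm{rec}}$ at states $s\notin\mathcal R$. Its value is $V^{\pi_\theta^{\mathrm{mix}}}(s_t)=\mathbb E\big[\sum_{j\ge0}\gamma^j r_{t+j}\mid s_t\big]$, the expectation being over trajectories generated by $\pi_\theta^{\mathrm{mix}}$ from $s_t$. The learned critic $V_\theta:\mathcal S\to\mathbb R$ is a parametric estimate of $V^{\pi_\theta^{\mathrm{mix}}}$. A recovery-triggering state is a state $s_t\notin\mathcal R$ at which the recovery policy takes over. The recovery policy then selects the actions at the steps $t,\dots,t+k-1$, and with deterministic $P$ and $\pi^{\mathrm{rec}}$ the states $s_{t+1},\dots,s_{t+k}$ and the rewards $r_t,\dots,r_{t+k-1}$ are determined by $s_t$. *)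

(* Defs.v *)
From HB Require Import structures.
From mathcomp Require Import all_boot all_order all_algebra.
From mathcomp Require Import all_classical all_reals all_analysis measurable_realfun.

Set Implicit Arguments.
Unset Strict Implicit.
Unset Printing Implicit Defensive.

Import Order.TTheory GRing.Theory Num.Theory.
Import numFieldNormedType.Exports.

Local Open Scope classical_set_scope.
Local Open Scope ring_scope.

(* [reward s a s'] is the reward r_t of the transition
   (s_t, a_t, s_{t+1}) = (s, a, s').  The end of an episode is encoded in the
   usual way: a failure state is never left and pays nothing any more, so that
   infinite-horizon sums are sums over the episode. *)
Record mdp (R : realType) (dS dA : measure_display)
    (S : measurableType dS) (A : measurableType dA) := MDP {
  dynamics : R.-pker (S * A)%type ~> S ;
  reward : S -> A -> S -> R ;
  reward_max : R ;
  discount : R ;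
  failure : set S ;
  measurable_reward :
    measurable_fun setT (fun x : S * A * S => reward x.1.1 x.1.2 x.2) ;
  reward_bounded : forall s a s', `|reward s a s'| <= reward_max ;
  discount_gt0 : 0 < discount ;
  discount_lt1 : discount < 1 ;
  measurable_failure : measurable failure ;
  failure_absorbing : forall s a, failure s ->
    forall B, measurable B -> dynamics (s, a) B = \d_s B ;
  failure_reward0 : forall s a s', failure s -> reward s a s' = 0
}.

(* Equality of measures, hence restricted to measurable sets; the
   measurability of [f] is a consequence. *)
Definition deterministic (R : realType) (dX dY : measure_display)
    (X : measurableType dX) (Y : measurableType dY)
    (k : R.-pker X ~> Y) (f : X -> Y) : Prop :=
  forall x B, measurable B -> k x B = \d_(f x) B.

Section mixed_policy.
Context (R : realType) (dS dA : measure_display)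
  (S : measurableType dS) (A : measurableType dA).
Variables (main rec : R.-pker S ~> A) (Rg : set S) (mRg : measurable Rg).

(* The measurability of Rg is an argument only so that the kernel structure
   can be inferred. *)
Definition mixed_policy of measurable Rg : S -> {measure set A -> \bar R} :=
  fun s => if s \in Rg then main s else rec s.

Let measurable_mixed_policy U : measurable U ->
  measurable_fun [set: S] (mixed_policy mRg ^~ U).
Proof.
move=> mU.
rewrite (_ : mixed_policy mRg ^~ U =
  fun s => if s \in Rg then main s U else rec s U); last first.
  by apply/funext => s; rewrite /mixed_policy; case: ifP.
apply: measurable_fun_ifT; [|exact: measurable_kernel..].
apply: (measurable_fun_bool true); rewrite setTI.
rewrite (_ : _ @^-1` _ = Rg)//; apply/seteqP; split=> s /=.
  by rewrite -[_ = true]/(is_true (s \in Rg)) inE.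
by rewrite -[_ = true]/(is_true (s \in Rg)) inE.
Qed.

HB.instance Definition _ :=
  isKernel.Build _ _ _ _ R (mixed_policy mRg) measurable_mixed_policy.

Let mixed_policy_setT s : mixed_policy mRg s setT = 1%E.
Proof. by rewrite /mixed_policy; case: ifP => _; exact: prob_kernel. Qed.

HB.instance Definition _ :=
  Kernel_isProbability.Build _ _ _ _ R (mixed_policy mRg) mixed_policy_setT.

End mixed_policy.

Definition history (dS dA dO : measure_display) (S : measurableType dS)
    (A : measurableType dA) (Omega : measurableType dO)
    (state : nat -> Omega -> S) (action : nat -> Omega -> A) (m n : nat) :
    set (set Omega) :=
  <<s [set H | exists i (B : set S),
         [/\ (i < m)%N, measurable B & H = state i @^-1` B]]
      `|`
      [set H | exists i (C : set A),
         [/\ (i < n)%N, measurable C & H = action i @^-1` C]] >>.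

(* A realization of the controlled process: under [law s], (state, action) is the
   random trajectory that starts in s, draws the action of step n from the
   policy and the state of step n.+1 from the dynamics, conditionally on the
   whole past. *)
Record trajectories (R : realType) (dS dA dO : measure_display)
    (S : measurableType dS) (A : measurableType dA) (M : mdp R S A)
    (policy : R.-pker S ~> A) (Omega : measurableType dO) := Trajectories {
  state : nat -> Omega -> S ;
  action : nat -> Omega -> A ;
  law : S -> probability Omega R ;
  measurable_state : forall n, measurable_fun setT (state n) ;
  measurable_action : forall n, measurable_fun setT (action n) ;
  law_init : forall s B, measurable B -> law s (state 0 @^-1` B) = \d_s B ;
  law_action : forall s n H C, history state action n.+1 n H -> measurable C ->
    law s (H `&` action n @^-1` C) = (\int[law s]_(w in H) policy (state n w) C)%E ;
  law_state : forall s n H B, history state action n.+1 n.+1 H -> measurable B ->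
    law s (H `&` state n.+1 @^-1` B) =
    (\int[law s]_(w in H) dynamics M (state n w, action n w) B)%E
}.

Definition path_of (R : realType) (dS dA dO : measure_display)
    (S : measurableType dS) (A : measurableType dA) (M : mdp R S A)
    (policy : R.-pker S ~> A) (Omega : measurableType dO)
    (T : trajectories M policy Omega) (w : Omega) : nat -> S * A :=
  fun n => (state T n w, action T n w).

Section returns.
Context (R : realType) (dS dA : measure_display)
  (S : measurableType dS) (A : measurableType dA) (M : mdp R S A).
Implicit Type tau : nat -> S * A.

Definition step_reward tau (n : nat) : R :=
  reward M (tau n).1 (tau n).2 (tau n.+1).1.

Definition segment_return tau (t k : nat) : R :=
  \sum_(0 <= j < k) discount M ^+ j * step_reward tau (t + j).

Definition discounted_return tau : R :=
  limn (series (fun j => discount M ^+ j * step_reward tau j)).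

(* The trajectories under [law T s] start at s, so the clock is reset to 0 at
   the state whose value is taken. *)
Definition value (dO : measure_display) (policy : R.-pker S ~> A)
    (Omega : measurableType dO) (T : trajectories M policy Omega) (s : S) :
    \bar R :=
  'E_(law T s)[fun w => discounted_return (path_of T w)].

Variable Rg : set S.

(* A recovery phase of length k starts at time t: the states of the steps
   t, ..., t + k - 1 are unsafe and not terminal, and k is minimal such that
   the phase is over at time t + k.  The case i = 0 says that the state at
   time t is recovery-triggering. *)
Definition recovery_phase tau (t k : nat) : Prop :=
  [/\ (0 < k)%N,
      forall i, (i < k)%N -> ~ Rg (tau (t + i)).1 /\
                             ~ failure M (tau (t + i)).1 &
      Rg (tau (t + k)).1 \/ failure M (tau (t + k)).1].

Definition recovery_failure tau (t k : nat) : Prop :=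
  recovery_phase tau t k /\ failure M (tau (t + k)).1.

(* Should a failure state lie in the safe region, termination prevails. *)
Definition recovery_success tau (t k : nat) : Prop :=
  recovery_phase tau t k /\
  (Rg (tau (t + k)).1 /\ ~ failure M (tau (t + k)).1).

Definition follows_recovery (step : S * A -> S) (mu : S -> A)
    tau (t k : nat) : Prop :=
  forall i, (i < k)%N ->
    (tau (t + i)).2 = mu (tau (t + i)).1 /\
    (tau (t + i).+1).1 = step (tau (t + i)).

Definition recovery_reward_convention (mu : S -> A) (rterm : R) : Prop :=
  forall s s', ~ Rg s -> ~ failure M s ->
    (failure M s' -> reward M s (mu s) s' = rterm) /\
    (~ failure M s' -> reward M s (mu s) s' = 0).

(* The length is unique when it exists; 0 is a dummy for a recovery phase that
   never ends. *)
Definition recovery_length tau (t : nat) : nat :=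
  xget 0 [set k | recovery_phase tau t k].

(* The length of the phase is read off the trajectory, so along a random
   trajectory it is random too. *)
Definition buffer_value (critic : S -> R) tau (t : nat) : R :=
  let k := recovery_length tau t in
  if (tau (t + k)).1 \in failure M then segment_return tau t k
  else segment_return tau t k + discount M ^+ k * critic (tau (t + k)).1.

End returns.

(* Main.v *)
Require Import Defs.
From HB Require Import structures.
From mathcomp Require Import all_boot all_order all_algebra.
From mathcomp Require Import all_classical all_reals all_analysis measurable_realfun.

Set Implicit Arguments.
Unset Strict Implicit.
Unset Printing Implicit Defensive.

Import Order.TTheory GRing.Theory Num.Theory.
Import numFieldNormedType.Exports.

Local Open Scope classical_set_scope.
Local Open Scope ring_scope.

(* The law of the step [(X_n, A_n, X_{n+1})] depends only on the law of [X_n]: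
   the two conditioning formulas give it on rectangles, which determine a finite
   measure on a product.  Hence, started from a recovery-triggering state, the
   steps of the recovery phase have Dirac laws at the steps of [tau], and the
   step at time [k + i] has the law of the step at time [i] started from
   [s_{t+k}].  Dominated convergence writes the value as the discounted series of
   the mean rewards of single steps, and cutting that series at [k] gives
   [V(s_t) = G + gamma^k V(s_{t+k})] in both cases; a failure state has value
   zero because it is almost surely never left. *)

(** Measurable rectangles are stable under intersection, generate the product sigma-algebra and
    include the whole space, where [m1] is finite; uniqueness of measures applies. *)
Lemma measure_eq_rectangles (R : realType) (d1 d2 : measure_display)
    (T1 : measurableType d1) (T2 : measurableType d2)
    (m1 m2 : {measure set (T1 * T2) -> \bar R}) :
  (m1 setT < +oo)%E ->
  (forall B C, measurable B -> measurable C -> m1 (B `*` C) = m2 (B `*` C)) ->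
  forall E, measurable E -> m1 E = m2 E.
Proof.
move=> m1oo m12 E mE.
apply: (measure_unique [set B `*` C | B in measurable & C in measurable]
  (fun=> setT)) mE => //.
- exact: measurable_prod_measurableType.
- move=> _ _ [B1 mB1 [C1 mC1 <-]] [B2 mB2 [C2 mC2 <-]].
  exists (B1 `&` B2); first exact: measurableI.
  by exists (C1 `&` C2); [exact: measurableI|rewrite setXI].
- by move=> _; exists setT => //; exists setT => //; rewrite setXTT.
- by rewrite bigcup_const.
- by move=> _ [B mB [C mC <-]]; exact: m12.
Qed.

(** * Laws of states, actions and transitions *)

Section marginals.
Context (R : realType) (dS dA dO : measure_display)
  (S : measurableType dS) (A : measurableType dA) (Omega : measurableType dO)
  (M : mdp R S A) (policy : R.-pker S ~> A) (T : trajectories M policy Omega).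

Local Notation X := (state T).
Local Notation U := (action T).

Definition transition (n : nat) (w : Omega) : S * A * S :=
  (X n w, U n w, X n.+1 w).

Lemma measurable_state_action n : measurable_fun setT (fun w => (X n w, U n w)).
Proof.
by apply: measurable_fun_pair;
  [exact: measurable_state|exact: measurable_action].
Qed.

Lemma measurable_transition n : measurable_fun setT (transition n).
Proof.
by apply: measurable_fun_pair;
  [exact: measurable_state_action|exact: measurable_state].
Qed.

Lemma preimage_transition_next n (B : set S) :
  transition n @^-1` (setT `*` B) = X n.+1 @^-1` B.
Proof. by apply/seteqP; split=> w //= []. Qed.

Lemma history_state n B : measurable B ->
  history X U n.+1 n (X n @^-1` B).
Proof. by move=> mB; apply: sub_sigma_algebra; left; exists n, B. Qed.

(** Over the history sigma-algebra both coordinates are measurable, hence so is their pair; this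
    reaches every measurable [E], not only rectangles, as conditioning the next state on the pair
    requires. *)
Lemma history_state_action n E : measurable E ->
  history X U n.+1 n.+1 ((fun w => (X n w, U n w)) @^-1` E).
Proof.
move=> mE; rewrite /history; set G := (G in <<s G >>).
have mX : measurable_fun setT (X n : g_sigma_algebraType G -> S).
  move=> _ B mB; rewrite setTI; apply: sub_sigma_algebra; left.
  by exists n, B.
have mU : measurable_fun setT (U n : g_sigma_algebraType G -> A).
  move=> _ B mB; rewrite setTI; apply: sub_sigma_algebra; right.
  by exists n, B.
have := measurable_fun_pair mX mU.
by move=> /(_ measurableT _ mE); rewrite setTI.
Qed.

Lemma state_action_rectangle s n B C : measurable B -> measurable C ->
  law T s ((fun w => (X n w, U n w)) @^-1` (B `*` C)) =
  (\int[pushforward (law T s) (X n)]_(x in B) policy x C)%E.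
Proof.
move=> mB mC; rewrite ge0_integral_pushforward//.
- by rewrite -law_action//; exact: history_state.
- exact: measurable_state.
- exact: measurable_funTS (measurable_kernel _ _ _).
Qed.

Lemma transition_rectangle s n E B : measurable E -> measurable B ->
  law T s (transition n @^-1` (E `*` B)) =
  (\int[pushforward (law T s) (fun w => (X n w, U n w))]_(x in E)
    dynamics M x B)%E.
Proof.
move=> mE mB; rewrite ge0_integral_pushforward//.
- by rewrite -law_state//; exact: history_state_action.
- exact: measurable_state_action.
- exact: measurable_funTS (measurable_kernel _ _ _).
Qed.

(** The measures [nu] and [mu] are left free: push-forwards when two steps are compared, Dirac
    masses during recovery. *)
Lemma state_action_law s n (nu : {measure set S -> \bar R})
    (mu : {measure set (S * A) -> \bar R}) :
  (forall B, measurable B -> law T s (X n @^-1` B) = nu B) ->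
  (forall B C, measurable B -> measurable C ->
    mu (B `*` C) = (\int[nu]_(x in B) policy x C)%E) ->
  forall E, measurable E -> law T s ((fun w => (X n w, U n w)) @^-1` E) = mu E.
Proof.
move=> Xnu muE; have mXU := measurable_state_action n.
have mX := measurable_state T n.
apply: (@measure_eq_rectangles _ _ _ _ _
  (pushforward (law T s) (fun w => (X n w, U n w)))) => // [|B C mB mC].
  by rewrite /= /pushforward preimage_setT probability_setT ltry.
rewrite muE// [LHS]state_action_rectangle//.
apply: (@eq_measure_integral _ _ _ _ nu (pushforward (law T s) (X n))) => //.
by move=> D mD _; exact: Xnu.
Qed.

Lemma transition_law s n (mu : {measure set (S * A) -> \bar R})
    (m : {measure set (S * A * S) -> \bar R}) :
  (forall E, measurable E ->
    law T s ((fun w => (X n w, U n w)) @^-1` E) = mu E) ->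
  (forall E B, measurable E -> measurable B ->
    m (E `*` B) = (\int[mu]_(x in E) dynamics M x B)%E) ->
  forall D, measurable D -> law T s (transition n @^-1` D) = m D.
Proof.
move=> XUmu m_E; have mXU := measurable_state_action n.
have mt := measurable_transition n.
apply: (@measure_eq_rectangles _ _ _ _ _
  (pushforward (law T s) (transition n))) => // [|E B mE mB].
  by rewrite /= /pushforward preimage_setT probability_setT ltry.
rewrite m_E// [LHS]transition_rectangle//.
apply: (@eq_measure_integral _ _ _ _ mu
  (pushforward (law T s) (fun w => (X n w, U n w)))) => //.
by move=> D mD _; exact: XUmu.
Qed.

(** The Markov property at the level of one-step marginals: policy and dynamics depend neither on
    the step nor on the starting state, so equal laws of the current state propagate to the pair and
    then to the triple. *)
Lemma transition_law_eq s s' n n' :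
  (forall B, measurable B -> law T s (X n @^-1` B) = law T s' (X n' @^-1` B)) ->
  forall D, measurable D ->
    law T s (transition n @^-1` D) = law T s' (transition n' @^-1` D).
Proof.
move=> XX; have mX' := measurable_state T n'.
have mXU' := measurable_state_action n'.
have mt' := measurable_transition n'.
have XU E : measurable E -> law T s ((fun w => (X n w, U n w)) @^-1` E) =
    law T s' ((fun w => (X n' w, U n' w)) @^-1` E).
  apply: (@state_action_law _ _ (pushforward (law T s') (X n'))
    (pushforward (law T s') (fun w => (X n' w, U n' w)))) => //.
  by move=> B C mB mC; exact: state_action_rectangle.
apply: (@transition_law _ _ (pushforward (law T s') (fun w => (X n' w, U n' w)))
  (pushforward (law T s') (transition n'))) => //.
by move=> E B mE mB; exact: transition_rectangle.
Qed.

(* [\d_a] stands for "almost surely [a]": singletons need not be measurable. *)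
Lemma transition_law_dirac s n x a y :
  (forall B, measurable B -> law T s (X n @^-1` B) = \d_x B) ->
  (forall C, measurable C -> policy x C = \d_a C) ->
  (forall B, measurable B -> dynamics M (x, a) B = \d_y B) ->
  forall D, measurable D -> law T s (transition n @^-1` D) = \d_(x, a, y) D.
Proof.
move=> Xx xa xay.
have diracX d1 d2 (T1 : measurableType d1) (T2 : measurableType d2) (x1 : T1)
    (x2 : T2) B C : (\d_(x1, x2) (B `*` C) = \d_x1 B * \d_x2 C :> \bar R)%E.
  by rewrite !diracE in_setX -EFinM -natrM mulnb.
apply: (@transition_law _ _ (\d_(x, a)) (\d_(x, a, y))).
  apply: (@state_action_law _ _ (\d_x)) => // B C mB mC.
  rewrite integral_dirac//; last first.
    exact: measurable_funTS (measurable_kernel _ _ _).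
  by rewrite xa//; exact: diracX.
move=> E B mE mB.
rewrite integral_dirac//; last first.
  exact: measurable_funTS (measurable_kernel _ _ _).
by rewrite xay//; exact: diracX.
Qed.

End marginals.

(** * Mean step rewards and the value as their discounted series *)

Section mean_rewards.
Context (R : realType) (dS dA dO : measure_display)
  (S : measurableType dS) (A : measurableType dA) (Omega : measurableType dO)
  (M : mdp R S A) (policy : R.-pker S ~> A) (T : trajectories M policy Omega).

Local Notation gamma := (discount M).

Definition reward_of (x : S * A * S) : R := reward M x.1.1 x.1.2 x.2.

Lemma measurable_step_reward n :
  measurable_fun setT (fun w => step_reward M (path_of T w) n).
Proof.
exact: (measurableT_comp (measurable_reward M) (measurable_transition T n)).
Qed.

Lemma integrable_step_reward s n :
  (law T s).-integrable setT (fun w => (step_reward M (path_of T w) n)%:E).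
Proof.
apply: measurable_bounded_integrable => //.
- by rewrite [ltLHS]probability_setT ltry.
- exact: measurable_step_reward.
- exists (reward_max M); split; first exact: num_real.
  by move=> m /ltW Mm w _ /=; exact: le_trans (reward_bounded _ _ _ _) Mm.
Qed.

Definition mean_reward s n : R :=
  fine 'E_(law T s)[fun w => step_reward M (path_of T w) n].

Lemma mean_rewardE s n :
  (\int[law T s]_w (step_reward M (path_of T w) n)%:E = (mean_reward s n)%:E)%E.
Proof.
rewrite /mean_reward unlock fineK//.
by apply: integrable_fin_num => //; exact: integrable_step_reward.
Qed.

(** The step reward is a fixed function of the transition, so its mean is an integral against the
    push-forward law of the transition. *)
Lemma mean_reward_law s s' n n' :
  (forall D, measurable D ->
    law T s (transition T n @^-1` D) = law T s' (transition T n' @^-1` D)) ->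
  mean_reward s n = mean_reward s' n'.
Proof.
move=> ss'; apply: EFin_inj; rewrite -!mean_rewardE.
have mt := measurable_transition T n; have mt' := measurable_transition T n'.
have mr : measurable_fun setT (EFin \o reward_of).
  by apply/measurable_EFinP; exact: measurable_reward.
transitivity (
  \int[pushforward (law T s) (transition T n)]_x (reward_of x)%:E)%E.
  rewrite (integral_pushforward mt mr)//.
  exact: integrable_step_reward.
transitivity (
  \int[pushforward (law T s') (transition T n')]_x (reward_of x)%:E)%E.
  apply: (@eq_measure_integral _ _ _ _
    (pushforward (law T s') (transition T n'))
    (pushforward (law T s) (transition T n))) => //.
  by move=> D mD _; exact: ss'.
rewrite (integral_pushforward mt' mr)//.
exact: integrable_step_reward.
Qed.

Lemma mean_reward_as s n c E : measurable E -> law T s E = 1%E ->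
  (forall w, E w -> step_reward M (path_of T w) n = c) ->
  mean_reward s n = c.
Proof.
move=> mE E1 Ec; apply: EFin_inj; rewrite -mean_rewardE.
rewrite (@ae_eq_integral _ _ _ (law T s) _ (cst c%:E))//.
- by rewrite integral_cst// [X in (_ * X)%E]probability_setT mule1.
- by apply/measurable_EFinP; exact: measurable_step_reward.
- exists (~` E); split; first exact: measurableC.
    by rewrite [LHS]probability_setC// [X in (_ - X)%E]E1 subee.
  by move=> w /= nc Ew; apply: nc => _; rewrite Ec.
Qed.

Lemma reward_max_ge0 : 0 <= reward_max M.
Proof.
(* Measurable types are pointed, so there is a transition at which to read the reward bound. *)
by apply: le_trans (normr_ge0 _) (reward_bounded M point point point).
Qed.

(** Comparison with the geometric series. The bound is uniform in [n]: it gives absolute convergence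
    and also the dominating constant for the partial returns. *)
Lemma discounted_series_bound (u : nat -> R) n :
  (forall j, `|u j| <= reward_max M) ->
  series (fun j => `|gamma ^+ j * u j|) n <= reward_max M * (1 - gamma)^-1.
Proof.
move=> ub.
have g0 := discount_gt0 M; have g1 := discount_lt1 M.
apply: (le_trans _ (@geometric_le_lim _ n _ gamma reward_max_ge0 g0 _));
  last first.
  by rewrite gtr0_norm.
apply: ler_sum => j _; rewrite normrM ger0_norm; last first.
  by rewrite exprn_ge0// ltW.
by rewrite mulrC ler_wpM2r// exprn_ge0// ltW.
Qed.

Lemma cvg_discounted_series (u : nat -> R) :
  (forall j, `|u j| <= reward_max M) ->
  cvgn (series (fun j => gamma ^+ j * u j)).
Proof.
move=> ub; apply: normed_cvg.
apply: nondecreasing_is_cvgn.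
  move=> m n mn; rewrite /=.
  apply: (@nondecreasing_series R (fun j => `|gamma ^+ j * u j|) xpredT 0%N
    _ _ _ mn) => j _ _ /=.
  exact: normr_ge0.
exists (reward_max M * (1 - gamma)^-1) => _ [n _ <-].
exact: discounted_series_bound.
Qed.

Lemma mean_reward_le s n : `|mean_reward s n| <= reward_max M.
Proof.
rewrite -lee_fin -[leLHS]/(`|(mean_reward s n)%:E|)%E -mean_rewardE.
apply: (le_trans (le_abse_integral _ _ _)) => //.
  by apply/measurable_EFinP; exact: measurable_step_reward.
apply: (@le_trans _ _ (\int[law T s]_w (reward_max M)%:E)%E).
  apply: ge0_le_integral => //.
  - apply: measurableT_comp => //.
    by apply/measurable_EFinP; exact: measurable_step_reward.
  - by move=> w _; rewrite lee_fin reward_bounded.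
by rewrite integral_cst// [X in (_ * X)%E]probability_setT mule1.
Qed.

Lemma value_series s :
  value T s = (limn (series (fun j => gamma ^+ j * mean_reward s j)))%:E.
Proof.
rewrite /value unlock.
pose f_ n w :=
  (series (fun j => gamma ^+ j * step_reward M (path_of T w) j) n)%:E.
have mf_ n : measurable_fun setT (f_ n).
  apply/measurable_EFinP; apply: measurable_sum => j.
  by apply: measurable_funM => //; exact: measurable_step_reward.
have cf w : f_ ^~ w @ \oo --> (discounted_return M (path_of T w))%:E.
  apply/cvg_EFin; first by apply: nearW.
  by apply: cvg_discounted_series => j; exact: reward_bounded.
have [||||_ _ cvgf] := @dominated_convergence _ _ _ (law T s) _ measurableT f_
  (fun w => (discounted_return M (path_of T w))%:E)
  (EFin \o cst (reward_max M * (1 - gamma)^-1)) mf_.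
- apply/measurable_EFinP.
  (* The return is a pointwise limit of the measurable partial returns. *)
  apply: (measurable_fun_cvg (h := fun n w => fine (f_ n w))).
    by move=> n; apply/measurable_EFinP; exact: mf_.
  by move=> w _; apply: cvg_discounted_series => j; exact: reward_bounded.
- by apply: aeW => w _; exact: cf.
- by apply: finite_measure_integrable_cst.
- apply: aeW => w n _; rewrite lee_fin.
  apply: (le_trans (ler_norm_sum _ _ _)); apply: discounted_series_bound => j.
  exact: reward_bounded.
(* The expected partial returns tend to the expected return by domination; by linearity they are
   also the partial sums of the series of mean rewards, and limits are unique. *)
apply/esym; apply: (cvg_unique (@ereal_hausdorff R)) _ cvgf.
rewrite (_ : [sequence _]_n =
    EFin \o series (fun j => gamma ^+ j * mean_reward s j)).
  apply/cvg_EFin; first by apply: nearW.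
  by apply: cvg_discounted_series => j; exact: mean_reward_le.
apply/funext => n /=.
under eq_integral do rewrite /f_ /series /= -sumEFin.
rewrite integral_sum//; last first.
  move=> j; under eq_fun do rewrite EFinM.
  by apply: integrableZl => //; exact: integrable_step_reward.
rewrite /series/= -sumEFin; apply: eq_bigr => j _.
under eq_integral do rewrite EFinM.
by rewrite integralZl//; [rewrite mean_rewardE|exact: integrable_step_reward].
Qed.

End mean_rewards.

(** * Almost sure equality, integrals and variance *)

(* [f] and [g] may be nonmeasurable: a simple function below one of them becomes,
   after multiplication by an indicator of full measure, a simple function below
   the other. *)
Section integral_ae_eq.
Import HBNNSimple.

Lemma integral_ae_eq d (T : measurableType d) (R : realType)
    (mu : {measure set T -> \bar R}) (f g : T -> \bar R) :
  {ae mu, forall x, f x = g x} -> (\int[mu]_x f x = \int[mu]_x g x)%E.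
Proof.
case=> N [mN N0 fgN].
have fg x : ~ N x -> f x = g x by move=> nNx; apply: contrapT => /fgN.
pose nnintegral (u : T -> \bar R) :=
  ereal_sup [set sintegral mu h | h in [set h : {nnsfun T >-> R} |
    forall x, ((h x)%:E <= u x)%E]].
have le_nnint (u v : T -> \bar R) : (forall x, (0 <= v x)%E) ->
    (forall x, ~ N x -> u x = v x) -> (nnintegral u <= nnintegral v)%E.
  move=> v0 uv; apply: ge_ereal_sup => _ [h /= hu <-].
  pose h' := proj_nnsfun h (measurableC mN).
  have <- : sintegral mu h' = sintegral mu h.
    rewrite -!integralT_nnsfun; apply: ae_eq_integral => //.
    - by apply/measurable_EFinP.
    - by apply/measurable_EFinP.
    exists N; split => // x /= nh; apply: contrapT => nNx; apply: nh => _.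
    by rewrite /h' /= mindicE mem_set// mulr1.
  apply: ereal_sup_ubound; exists h' => //= x.
  rewrite mindicE; case: (boolP (x \in ~` N)) => xN.
    by rewrite mulr1 -uv//; exact: set_mem.
  by rewrite mulr0.
rewrite /integral; congr (_ - _)%E; apply/eqP;
  rewrite eq_le !le_nnint// => x nNx;
  by rewrite unlock !patch_setT fg.
Qed.

End integral_ae_eq.

(** The mean is [c], so the squared deviation vanishes almost everywhere. Going through
    [integral_ae_eq] spares a measurability proof for the buffer value, which is read off a random
    recovery length. *)
Lemma variance_ae_cst d (T : measurableType d) (R : realType)
    (P : probability T R) (Y : T -> R) (c : R) :
  {ae P, forall x, Y x = c} -> 'V_P[Y] = 0%E.
Proof.
move=> Yc.
have EY : ('E_P[Y] = c%:E)%E.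
  rewrite unlock (@integral_ae_eq _ _ _ _ _ (cst c%:E)).
    by rewrite integral_cst// [X in (_ * X)%E]probability_setT mule1.
  by apply: filterS Yc => x ->.
rewrite /variance unlock EY unlock (@integral_ae_eq _ _ _ _ _ (cst 0%E)).
  by rewrite integral0.
by apply: filterS Yc => x Yx; rewrite !fctE/= Yx subrr mul0r.
Qed.

(** A Dirac law is exploited through a measurable set containing the atom, since the atom alone may
    fail to be measurable. *)
Lemma ae_dirac d dY (T : measurableType d) (Y : measurableType dY)
    (R : realType) (P : probability T R) (f : T -> Y) (y : Y) (Q : set Y) :
  measurable_fun setT f -> measurable Q -> P (f @^-1` Q) = \d_y Q -> Q y ->
  {ae P, forall w, Q (f w)}.
Proof.
move=> mf mQ fy Qy.
have mfQ : measurable (f @^-1` Q).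
  by rewrite -[X in measurable X]setTI; exact: mf.
exists (~` (f @^-1` Q)); split => //; first exact: measurableC.
by rewrite [LHS]probability_setC// [X in (_ - X)%E]fy diracE mem_set// subee.
Qed.

(** * Recovery phases along a fixed trajectory *)

Section recovery_phases.
Context (R : realType) (dS dA : measure_display)
  (S : measurableType dS) (A : measurableType dA) (M : mdp R S A) (Rg : set S).

(** Of two phases with the same start, the end of a strictly shorter one would be an interior state
    of the longer one, hence neither safe nor terminal. *)
Lemma recovery_phase_length tau t k :
  recovery_phase M Rg tau t k -> recovery_length M Rg tau t = k.
Proof.
move=> phk; apply: (xget_subset1 0) => //.
suff le k1 k2 : recovery_phase M Rg tau t k1 -> recovery_phase M Rg tau t k2 ->
    (k2 <= k1)%N.
  by move=> k1 k2 ph1 ph2; apply/eqP; rewrite eqn_leq !le.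
move=> [_ _ end1] [_ before2 _]; rewrite leqNgt; apply/negP => /before2[nR nF].
by case: end1.
Qed.

Lemma buffer_value_success critic tau t k : recovery_success M Rg tau t k ->
  buffer_value M Rg critic tau t =
  segment_return M tau t k + discount M ^+ k * critic (tau (t + k)%N).1.
Proof.
move=> [phk [_ nF]]; rewrite /buffer_value (recovery_phase_length phk).
by rewrite (memNset nF).
Qed.

Lemma segment_return_success step mu rterm tau t k :
  recovery_reward_convention M Rg mu rterm -> follows_recovery step mu tau t k ->
  recovery_success M Rg tau t k -> segment_return M tau t k = 0.
Proof.
move=> conv rec [[_ before _] [_ nFk]].
rewrite /segment_return big_nat; apply: big1 => j /andP[_ jk].
have [nR nF] := before j jk; rewrite /step_reward (rec j jk).1.
rewrite ((conv _ _ nR nF).2 _) ?mulr0//.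
(* The state entered is nonfailure: the last one because recovery succeeds, an earlier one because
   it is interior to the phase. *)
move: jk; rewrite leq_eqVlt => /predU1P[jk|/before[_]]; last first.
  by rewrite natrDE addnS.
by move: nFk; rewrite -jk natrDE addnS.
Qed.

Lemma segment_return_failure step mu rterm tau t k :
  recovery_reward_convention M Rg mu rterm -> follows_recovery step mu tau t k ->
  recovery_failure M Rg tau t k ->
  segment_return M tau t k = discount M ^+ k.-1 * rterm.
Proof.
move=> conv rec [[k0 before _] Fk]; case: k k0 => // k _ in rec before Fk *.
(* The length being now [k.+1], the term of index [k] is split off: its transition enters the
   failure state and pays [rterm], while the earlier ones stay inside the phase and pay zero. *)
rewrite /segment_return big_nat_recr//= big_nat big1 ?add0r => [|j /andP[_ jk]].
  have [nR nF] := before k (ltnSn k); rewrite /step_reward (rec k (ltnSn k)).1.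
  by rewrite ((conv _ _ nR nF).1 _)// -addnS -natrDE.
have [nR nF] := before j (ltnW jk); rewrite /step_reward (rec j (ltnW jk)).1.
rewrite ((conv _ _ nR nF).2 _) ?mulr0// -addnS -natrDE.
exact: (before j.+1 _).2.
Qed.

End recovery_phases.

(** * The value of a failure state *)

Section failure_value.
Context (R : realType) (dS dA dO : measure_display)
  (S : measurableType dS) (A : measurableType dA) (Omega : measurableType dO)
  (M : mdp R S A) (policy : R.-pker S ~> A) (T : trajectories M policy Omega).

(** Induction on [n]: conditionally on a failure state at step [n], absorption gives the next
    failure event probability one, whatever the action. *)
Lemma law_failure s n :
  failure M s -> law T s (state T n @^-1` failure M) = 1%E.
Proof.
move=> Fs; have mF := measurable_failure M.
have mXF i : measurable (state T i @^-1` failure M).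
  by rewrite -[X in measurable X]setTI; exact: measurable_state.
elim: n => [|n IHn]; first by rewrite law_init// diracE mem_set.
apply/eqP; rewrite eq_le probability_le1//= -IHn.
apply: (@le_trans _ _
    (law T s (state T n @^-1` failure M `&` state T n.+1 @^-1` failure M))).
  rewrite law_state//.
    rewrite (eq_integral (cst 1%E)).
      by rewrite integral_cst// mul1e.
    move=> w /set_mem/= Fw.
    by rewrite (failure_absorbing _ Fw mF) diracE mem_set.
  (* The event is rewritten as one on the state-action pair, to place it in the history that
     precedes the next state. *)
  rewrite (_ : state T n @^-1` failure M =
      (fun w => (state T n w, action T n w)) @^-1` (failure M `*` setT)).
    by apply: history_state_action; exact: measurableX.
  by apply/seteqP; split=> w //= [].
by apply: le_measure; rewrite ?inE//; exact: measurableI.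
Qed.

Lemma value_failure s : failure M s -> value T s = 0%E.
Proof.
move=> Fs; rewrite value_series.
rewrite (_ : (fun j => _) = (fun=> 0)); last first.
  apply/funext => j; rewrite (@mean_reward_as _ _ _ _ _ _ _ _ _ _ _ _ 0
    (state T j @^-1` failure M)) ?mulr0//.
  - rewrite -[X in measurable X]setTI; apply: measurable_state => //.
    exact: measurable_failure.
  - exact: law_failure.
  - by move=> w Fw; exact: failure_reward0.
by rewrite (_ : series _ = cst 0) ?lim_cst//; apply/funext => n; exact: big1.
Qed.

End failure_value.

(** * Random trajectories started in a recovery-triggering state *)

Section recovery_trajectories.
Context (R : realType) (dS dA dO : measure_display)
  (S : measurableType dS) (A : measurableType dA) (Omega : measurableType dO)
  (M : mdp R S A) (Rg : set S) (mRg : measurable Rg)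
  (main rec : R.-pker S ~> A)
  (T : trajectories M (mixed_policy main rec mRg) Omega)
  (step : S * A -> S) (hP : deterministic (dynamics M) step)
  (mu : S -> A) (hrec : deterministic rec mu)
  (tau : nat -> S * A) (t k : nat)
  (htau : follows_recovery step mu tau t k)
  (hphase : recovery_phase M Rg tau t k).

Local Notation gamma := (discount M).
Local Notation s_ n := (tau n).1.

Lemma dynamics_recovery i : (i < k)%N -> forall B, measurable B ->
  dynamics M (s_ (t + i)%N, (tau (t + i)%N).2) B = \d_(s_ (t + i).+1%N) B.
Proof.
by move=> ik B mB; rewrite hP// -surjective_pairing (htau ik).2.
Qed.

Lemma policy_recovery i : (i < k)%N -> forall C, measurable C ->
  mixed_policy main rec mRg (s_ (t + i)%N) C = \d_((tau (t + i)%N).2) C.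
Proof.
move=> ik C mC; have [_ before _] := hphase.
rewrite /mixed_policy (memNset (before _ ik).1) hrec//.
by have [->] := htau ik.
Qed.

(** The clock of the random trajectory starts at 0, that of [tau] at [t]. The bound [i <= k]
    includes the state that ends the phase, where the process restarts. *)
Lemma law_state_recovery i : (i <= k)%N -> forall B, measurable B ->
  law T (s_ t) (state T i @^-1` B) = \d_(s_ (t + i)%N) B.
Proof.
elim: i => [_|i IHi ik] B mB; first by rewrite law_init// addn0.
have := transition_law_dirac (IHi (ltnW ik)) (policy_recovery ik)
  (dynamics_recovery ik) (measurableX measurableT mB).
rewrite addnS preimage_transition_next => ->.
by rewrite !diracE in_setX in_setT.
Qed.

Lemma law_transition_recovery i : (i < k)%N -> forall D, measurable D ->
  law T (s_ t) (transition T i @^-1` D) =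
  \d_(s_ (t + i)%N, (tau (t + i)%N).2, s_ (t + i).+1%N) D.
Proof.
move=> ik; apply: transition_law_dirac.
- exact: law_state_recovery (ltnW ik).
- exact: policy_recovery.
- exact: dynamics_recovery.
Qed.

Lemma mean_reward_recovery i : (i < k)%N ->
  mean_reward T (s_ t) i = step_reward M tau (t + i)%N.
Proof.
move=> ik; set c := step_reward _ _ _.
(* The event used is a level set of the reward: it is measurable and contains the atom of the
   transition law. *)
have mc : measurable (@reward_of _ _ _ _ _ M @^-1` [set c]).
  by rewrite -[X in measurable X]setTI; exact: measurable_reward.
apply: (@mean_reward_as _ _ _ _ _ _ _ _ _ _ _ _ _
  (transition T i @^-1` (@reward_of _ _ _ _ _ M @^-1` [set c]))) => //.
- by rewrite -[X in measurable X]setTI; exact: measurable_transition.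
- by rewrite law_transition_recovery// diracE mem_set.
Qed.

(** Restarting at time [k] by induction on marginal laws: the state at time [k] has the Dirac law of
    an initial state at [s_ (t + k)], and equal transition laws give equal laws of the next
    state. *)
Lemma mean_reward_after_recovery i :
  mean_reward T (s_ t) (i + k)%N = mean_reward T (s_ (t + k)%N) i.
Proof.
apply: mean_reward_law.
elim: i => [|i IHi] D mD; apply: transition_law_eq mD => B mB.
  by rewrite add0n law_state_recovery// law_init.
have := IHi _ (measurableX measurableT mB).
by rewrite addSn !preimage_transition_next.
Qed.

Lemma value_recovery : value T (s_ t) =
  ((segment_return M tau t k)%:E + (gamma ^+ k)%:E * value T (s_ (t + k)%N))%E.
Proof.
rewrite !value_series -EFinM -EFinD; congr EFin.
(* Shifting the partial sums by [k] makes each contain the whole recovery segment, leaving a partial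
   sum of the series at [s_ (t + k)] scaled by [gamma ^+ k]. *)
apply: cvg_lim => //; rewrite -(cvg_shiftn k).
set v := fun j => gamma ^+ j * mean_reward T (s_ (t + k)%N) j.
rewrite (_ : [sequence _]_n = fun n =>
    segment_return M tau t k + gamma ^+ k * series v n).
  apply: cvgD; [exact: cvg_cst|apply: cvgMr].
  by apply: cvg_discounted_series => j; exact: mean_reward_le.
apply/funext => n; rewrite /series/= (big_cat_nat (leq0n k) (leq_addl n k))/=.
congr (_ + _).
  by apply: eq_big_nat => j /andP[_ jk]; rewrite mean_reward_recovery.
rewrite -[X in \sum_(X <= _ < _) _]add0n big_addn addnK mulr_sumr.
apply: eq_bigr => j _.
by rewrite mean_reward_after_recovery exprD /v mulrA [_ ^+ j * _]mulrC.
Qed.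

(** Almost sure equality with [tau] is replaced by agreement on the measurable data that the buffer
    value reads: phase status, rewards and final critic value. *)
Lemma buffer_value_recovery_ae critic : measurable_fun setT critic ->
  recovery_success M Rg tau t k ->
  {ae law T (s_ t), forall w, buffer_value M Rg critic (path_of T w) 0 =
    segment_return M tau t k + gamma ^+ k * critic (s_ (t + k)%N)}.
Proof.
move=> mcritic [_ [Rk nFk]]; have [k0 before _] := hphase.
have mF := measurable_failure M.
pose Q i := [set x : S * A * S | (~ Rg x.1.1 /\ ~ failure M x.1.1) /\
  reward M x.1.1 x.1.2 x.2 = step_reward M tau (t + i)%N].
have mQ i : measurable (Q i).
  rewrite (_ : Q i = ((~` Rg `&` ~` failure M) `*` setT) `*` setT `&`
    (fun x : S * A * S => reward M x.1.1 x.1.2 x.2) @^-1`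
      [set step_reward M tau (t + i)%N]); last first.
    by apply/seteqP; split=> x /= [] => [[? ?] ?|[[] ? _ _ ?]].
  apply: measurableI.
    by do 2 (apply: measurableX => //); apply: measurableI; exact: measurableC.
  by rewrite -[X in measurable X]setTI; exact: measurable_reward.
(* Indexing by ['I_k] makes this a finite conjunction of almost sure events. *)
have aeQ : {ae law T (s_ t), forall w, forall i : 'I_k, Q i (transition T i w)}.
  apply: filter_forall => i.
  apply: ae_dirac (law_transition_recovery (ltn_ord i) (mQ i)) _ => //.
    exact: measurable_transition.
  by split; [exact: before|].
pose Qk := Rg `&` ~` failure M `&` critic @^-1` [set critic (s_ (t + k)%N)].
have mQk : measurable Qk.
  apply: measurableI; first by apply: measurableI => //; exact: measurableC.
  by rewrite -[X in measurable X]setTI; exact: mcritic.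
have aeQk : {ae law T (s_ t), forall w, Qk (state T k w)}.
  apply: ae_dirac (law_state_recovery (leqnn k) mQk) _ => //.
  exact: measurable_state.
apply: filterS2 aeQ aeQk => w Qw [[Rw nFw] cw].
(* On these events the random trajectory has a successful phase of length exactly [k] from time 0,
   which fixes its random recovery length. *)
have succ : recovery_success M Rg (path_of T w) 0 k.
  split; last by rewrite /= natrDE add0n.
  split=> // [i ik|]; last by left; rewrite /= natrDE add0n.
  by rewrite /= natrDE add0n; exact: (Qw (Ordinal ik)).1.
rewrite (buffer_value_success critic succ); congr (_ + _ * _).
  apply: eq_big_nat => i /andP[_ ik]; congr (_ * _).
  exact: (Qw (Ordinal ik)).2.
by rewrite /= add0n.
Qed.

End recovery_trajectories.

Theorem proposition6 (R : realType) (dS dA dO : measure_display)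
    (S : measurableType dS) (A : measurableType dA) (Omega : measurableType dO)
    (M : mdp R S A)
    (Rg : set S) (mRg : measurable Rg)
    (Theta : Type) (theta : Theta)
    (main : Theta -> R.-pker S ~> A) (rec : R.-pker S ~> A)
    (critic : Theta -> S -> R)
    (mcritic : forall th, measurable_fun setT (critic th))
    (T : trajectories M (mixed_policy (main theta) rec mRg) Omega)
    (step : S * A -> S) (hP : deterministic (dynamics M) step)
    (mu : S -> A) (hrec : deterministic rec mu)
    (tau : nat -> S * A) (t k : nat)
    (htau : follows_recovery step mu tau t k) :
  let s_ n := (tau n).1 in
  let G := segment_return M tau t k in
  let gamma := discount M in
  [/\ recovery_success M Rg tau t k ->
        value T (s_ t) = (G%:E + (gamma ^+ k)%:E * value T (s_ (t + k)%N))%E,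
      recovery_failure M Rg tau t k ->
        value T (s_ t) = G%:E &
      forall rterm : R, recovery_reward_convention M Rg mu rterm ->
        [/\ recovery_success M Rg tau t k -> G = 0,
            recovery_failure M Rg tau t k -> G = gamma ^+ k.-1 * rterm &
            recovery_success M Rg tau t k ->
              buffer_value M Rg (critic theta) tau t =
                gamma ^+ k * critic theta (s_ (t + k)%N) /\
              'V_(law T (s_ t))[fun w =>
                buffer_value M Rg (critic theta) (path_of T w) 0] = 0%E]].
Proof.
move=> s_ G gamma; split.
- by move=> [phase _]; exact: (value_recovery T hP hrec htau phase).
- move=> [phase Fk].
  rewrite (value_recovery T hP hrec htau phase).
  by rewrite (value_failure T Fk) mule0 adde0.
move=> rterm conv; split.
- exact: segment_return_success conv htau.
- exact: segment_return_failure conv htau.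
move=> success; have G0 := segment_return_success conv htau success.
split; first by rewrite (buffer_value_success _ success) G0 add0r.
(* Along the random trajectory the buffer value is almost surely the constant computed from
   [tau]. *)
apply: variance_ae_cst.
exact: (buffer_value_recovery_ae T hP hrec htau success.1 (mcritic theta)).
Qed.
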